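(* Let $\tau>2$ and $p_k=k^{-\tau}/\zeta(\tau)$, $k\in\mathbb N=\{1,2,\ldots\}$, with $\zeta$ the Riemann zeta function, and let $\Delta_\phi$ be the friendship bias of the root of the unimodular branching process tree with root offspring distribution $(p_k)_{k\in\mathbb N}$ (the local limit of the configuration model whose limiting degree distribution is $(p_k)$). Then $$\mathbb P\{\Delta_\phi\ge x\}\asymp\mathbb P\{d_1\ge x\},\qquad x\to\infty.$$ In particular, $$\mathbb P\{\Delta_\phi\ge x\}\asymp x^{-(\tau-2)},\qquad x\to\infty.$$
   Context: Let $D$ be a random variable with $\mathbb P\{D=k\}=p_k$. In the unimodular branching process tree with root offspring distribution $p=(p_k)$, the root $\phi$ has $d_\phi$ children with $\mathbb P\{d_\phi=k\}=p_k$, and every other vertex independently has a number of children distributed according to $p^\star_k=(k+1)p_{k+1}/\mathbb E[D]$, $k\in\mathbb N_0$. So $d_\phi$ and the numbers $d_1,d_2,\ldots$ of children of the children of the root are independent, $d_\phi\sim p$, and $d_j\sim p^\star$ for all $j$. The friendship bias of the root is $\Delta_\phi=\frac1{d_\phi}\sum_{j=1}^{d_\phi}(d_j+1)-d_\phi$ (note $d_\phi\ge1$). Notation: $a_x\asymp b_x$ as $x\to\infty$ means $0<\liminf_{x\to\infty}a_x/b_x\le\limsup_{x\to\infty}a_x/b_x<\infty$. *)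

(* Defs.v *)
From HB Require Import structures.
From mathcomp Require Import all_boot all_order all_algebra.
From mathcomp Require Import all_classical all_reals all_analysis.

Set Implicit Arguments.
Unset Strict Implicit.
Unset Printing Implicit Defensive.

Import Order.TTheory GRing.Theory Num.Theory.
Import numFieldNormedType.Exports.

Local Open Scope classical_set_scope.
Local Open Scope ring_scope.

(* Mutual independence of an arbitrary family: the product rule holds on
   every finite subfamily, a duplicate-free sequence of indices. *)
Definition mutually_independent d d' (T : measurableType d)
    (T' : measurableType d') (R : realType) (P : probability T R)
    (I : choiceType) (X : I -> {RV P >-> T'}) : Prop :=
  forall (s : seq I) (A : I -> set T'), uniq s ->
    (forall i, i \in s -> measurable (A i)) ->
    P (\bigcap_(i in [set` s]) (X i @^-1` A i)) =
    (\prod_(i <- s) P (X i @^-1` A i))%E.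

Definition has_pmf d (T : measurableType d) (R : realType)
    (P : probability T R) (X : {RV P >-> nat}) (p : nat -> R) : Prop :=
  forall k, P (X @^-1` [set k]) = (p k)%:E.

(* [m] stands for the mean of [p], i.e. for E[D] when D has law [p]. *)
Definition size_biased (R : realType) (p : nat -> R) (m : R) (k : nat) : R :=
  k.+1%:R * p k.+1 / m.

(* The tree is encoded by Ulam-Harris words: the root is [::], and the children
   of v are [rcons v j] for 1 <= j <= N v. Offspring numbers are attached to
   all words, including those outside the tree. *)
Record unimodular_bp d (T : measurableType d) (R : realType)
    (P : probability T R) (p : nat -> R) (N : seq nat -> {RV P >-> nat}) :
    Prop := UnimodularBP {
  ubp_indep : mutually_independent N ;
  ubp_root : has_pmf (N [::]) p ;
  ubp_offspring : forall v, v != [::] ->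
    has_pmf (N v) (size_biased p (fine ('E_P[fun t => (N [::] t)%:R])))
}.

Definition root_children d (T : measurableType d) (R : realType)
  (P : probability T R) (N : seq nat -> {RV P >-> nat}) : T -> nat := N [::].

Definition grandchildren d (T : measurableType d) (R : realType)
  (P : probability T R) (N : seq nat -> {RV P >-> nat}) (j : nat) : T -> nat :=
  N [:: j].

(* The average degree of the neighbours of the root minus the degree of the
   root; the summand 1 counts the edge from a child back to the root. The value
   is 0 on the event that the root has no children, which is null whenever the
   root offspring distribution has [p 0 = 0]. *)
Definition friendship_bias d (T : measurableType d) (R : realType)
    (P : probability T R) (N : seq nat -> {RV P >-> nat}) (t : T) : R :=
  (\sum_(1 <= j < (root_children N t).+1) (grandchildren N j t + 1)%N%:R) /
    (root_children N t)%:R - (root_children N t)%:R.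

Definition zeta (R : realType) (s : R) : R :=
  limn (fun n => \sum_(1 <= k < n) k%:R `^ (- s)).

Definition zeta_pmf (R : realType) (tau : R) (k : nat) : R :=
  if k is 0%N then 0 else k%:R `^ (- tau) / zeta tau.

Definition asymp (R : realType) (a b : R -> R) : Prop :=
  let r := fun x => (a x / b x)%:E in
  ((0 < limf_einf r (pinfty_nbhs R)) /\
   (limf_einf r (pinfty_nbhs R) <= limf_esup r (pinfty_nbhs R)) /\
   (limf_esup r (pinfty_nbhs R) < +oo))%E.

(* Main.v *)
(* An average that is at least x has a term that is at least x, so, on the event
   that the root has n children, a bias of at least x > 0 forces one of n
   independent grandchild counts to be at least x. Summing the union bound over
   n costs only the factor sum_n n p_n = E[D], whereas for n = 1 the bias equals
   d_1 exactly. Hence p_1 P(d_1 >= x) <= P(bias >= x) <= E[D] P(d_1 >= x). The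
   tail of d_1, whose law is proportional to (k+1)^(1-tau), is compared with
   x^(2-tau) by telescoping. *)
Require Import Defs.
From HB Require Import structures.
From mathcomp Require Import all_boot all_order all_algebra.
From mathcomp Require Import all_classical all_reals all_analysis.
From mathcomp Require Import measurable_realfun.
From mathcomp Require Import ring lra.

Set Implicit Arguments.
Unset Strict Implicit.
Unset Printing Implicit Defensive.

Import Order.TTheory GRing.Theory Num.Theory.
Import numFieldNormedType.Exports.

Local Open Scope classical_set_scope.
Local Open Scope ring_scope.

(** * Order-exact asymptotics from eventual two-sided bounds *)

Lemma asymp_of_bounds (R : realType) (a b : R -> R) (M c C : R) :
  0 < c -> (forall x, M <= x -> c <= a x / b x <= C) -> asymp a b.
Proof.
move=> c0 abM; rewrite /asymp; set r := fun x => _.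
have nM : pinfty_nbhs R [set x | M <= x].
  by apply: nbhs_pinfty_ge; exact: num_real.
split; last split.
- rewrite limf_einfE; apply: (@lt_le_trans _ _ c%:E); first by rewrite lte_fin.
  apply: le_trans (ereal_sup_ubound _); last by exists [set x | M <= x].
  apply: le_ereal_inf_tmp => _ [x Mx <-].
  by rewrite lee_fin; case/andP: (abM x Mx).
(* Any two sets of the filter meet, and a common point lies between the infimum over one and the
   supremum over the other. *)
- rewrite limf_einfE; apply: ge_ereal_sup => _ [U FU <-].
  apply: le_ereal_inf_tmp => _ [V FV <-].
  have [x [Ux Vx]] := filter_ex (filterI FU FV).
  apply: (@le_trans _ _ (r x)).
    by apply: ereal_inf_lbound; exists x.
  by apply: ereal_sup_ubound; exists x.
- apply: (@le_lt_trans _ _ C%:E); last exact: ltry.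
  apply: ge_ereal_inf; exists (ereal_sup (r @` [set x | M <= x])).
    by exists [set x | M <= x].
  apply: ge_ereal_sup => _ [x Mx <-].
  by rewrite lee_fin; case/andP: (abM x Mx).
Qed.

(** * Increments of negative powers *)

Section powR_telescope.
Variables (R : realType) (a : R).
Hypothesis a0 : 0 < a.

Let powRNE (x : R) : 0 < x -> x `^ (- a) = expR (- a * ln x).
Proof. by move=> x0; rewrite /powR gt_eqF. Qed.

Lemma ln_le_subr1 (x : R) : 0 < x -> ln x <= x - 1.
Proof.
move=> x0; have := @le_ln1Dx R (x - 1).
by rewrite [1 + _]addrC subrK; apply; lra.
Qed.

(** A mean value bound without derivatives: factor out the power of [y], then apply
    [1 + u <= expR u] to the quotient and [ln u <= u - 1] to [u = x / y]. *)
Lemma powRN_sub_ge (x y : R) : 0 < x -> x <= y ->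
  a * (y - x) * y `^ (- (a + 1)) <= x `^ (- a) - y `^ (- a).
Proof.
move=> x0 xy; have y0 : 0 < y by lra.
have -> : y `^ (- (a + 1)) = y `^ (- a) / y.
  rewrite opprD powRD ?powR_inv1 ?(ltW y0)//.
  by rewrite (gt_eqF y0) implybT.
have xy1 : ln x - ln y <= x / y - 1.
  by rewrite -ln_div ?posrE//; apply: ln_le_subr1; rewrite divr_gt0.
have h := expR_ge1Dx (- (a * (ln x - ln y))).
have E : x `^ (- a) = y `^ (- a) * expR (- (a * (ln x - ln y))).
  by rewrite !powRNE// -expRD; congr expR; ring.
rewrite E; set c := y `^ _; set e := expR _.
have -> : a * (y - x) * (c / y) = c * (a * (1 - x / y)) by field; lra.
have -> : c * e - c = c * (e - 1) by ring.
rewrite ler_wpM2l ?powR_ge0//.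
apply: (@le_trans _ _ (- (a * (ln x - ln y)))); last by rewrite /e; lra.
by rewrite -[leRHS]mulrN ler_wpM2l ?(ltW a0)//; move: xy1; set q := x / y; lra.
Qed.

(** The same two inequalities, now with the power of [x] factored out. *)
Lemma powRN_sub_le (x y : R) : 0 < x -> x <= y ->
  x `^ (- a) - y `^ (- a) <= a * (y - x) * x `^ (- (a + 1)).
Proof.
move=> x0 xy; have y0 : 0 < y by lra.
have -> : x `^ (- (a + 1)) = x `^ (- a) / x.
  rewrite opprD powRD ?powR_inv1 ?(ltW x0)//.
  by rewrite (gt_eqF x0) implybT.
have yx : ln y - ln x <= y / x - 1.
  by rewrite -ln_div ?posrE//; apply: ln_le_subr1; rewrite divr_gt0.
have h := expR_ge1Dx (a * (ln x - ln y)).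
have E : y `^ (- a) = x `^ (- a) * expR (a * (ln x - ln y)).
  by rewrite !powRNE// -expRD; congr expR; ring.
rewrite E; set c := x `^ _; set e := expR _.
have -> : a * (y - x) * (c / x) = c * (a * (y / x - 1)) by field; lra.
have -> : c - c * e = c * (1 - e) by ring.
rewrite ler_wpM2l ?powR_ge0// (@le_trans _ _ (a * (ln y - ln x)))//.
  by rewrite /e; lra.
by rewrite ler_wpM2l// ltW.
Qed.

Lemma ge_powRN (x y : R) : 0 < x -> x <= y -> y `^ (- a) <= x `^ (- a).
Proof.
move=> x0 xy; have y0 := lt_le_trans x0 xy.
rewrite !powRN lef_pV2 ?posrE ?powR_gt0//.
by apply: ge0_ler_powR; rewrite ?nnegrE ?(ltW x0) ?(ltW y0) ?(ltW a0).
Qed.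

Lemma powRN_eventually_le (e : R) : 0 < e ->
  exists K : nat, forall k : nat, (K <= k)%N -> k%:R `^ (- a) <= e.
Proof.
(* This [y] is the point where the power with exponent [- a] equals [e]. *)
move=> e0; set y := e^-1 `^ (a^-1).
exists (Num.Def.archi_bound y) => k Kk.
have y0 : 0 < y by rewrite powR_gt0// invr_gt0.
have yk : y <= k%:R.
  by rewrite (le_trans (ltW (archi_boundP (ltW y0))))// ler_nat.
rewrite powRN -[leRHS]invrK lef_pV2 ?posrE ?invr_gt0 ?powR_gt0//;
  last exact: lt_le_trans yk.
have -> : e^-1 = y `^ a.
  by rewrite -powRrM mulVf ?gt_eqF// powRr1// invr_ge0 ltW.
by apply: ge0_ler_powR; rewrite ?nnegrE ?ler0n ?(ltW y0) ?(ltW a0).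
Qed.

End powR_telescope.

(** * Laws and tails of integer-valued random variables *)

Section nat_random_variable.
Context d (T : measurableType d) (R : realType) (P : probability T R).
Implicit Types (X Y : {RV P >-> nat}) (p : nat -> R) (A : set nat).

Lemma measurable_RV_nat X A : measurable (X @^-1` A).
Proof. exact: measurable_funPTI. Qed.

Lemma RV_nat_series X A :
  P (X @^-1` A) = (\sum_(0 <= k <oo | k \in A) P (X @^-1` [set k]))%E.
Proof.
rewrite -measure_bigcup; first last.
- apply/trivIsetP => i j _ _ ij; rewrite -subset0 => t [/= -> /eqP].
  by rewrite (negPf ij).
- by move=> k _; exact: measurable_RV_nat.
- by congr (P _); apply/seteqP; split=> [t At|t [k Ak /= ->//]]; exists (X t).
Qed.

Lemma has_pmf_series X p : has_pmf X p ->
  (\sum_(0 <= k <oo) (p k)%:E)%E = 1%E.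
Proof.
move=> Xp; rewrite -(probability_setT P) -(preimage_setT X) RV_nat_series.
rewrite [RHS](@eq_eseriesl _ _ xpredT) => [|k]; last by rewrite in_setT.
by apply: eq_eseriesr => k _; rewrite Xp.
Qed.

Lemma has_pmf_ge0 X p k : has_pmf X p -> 0 <= p k.
Proof. by move=> Xp; rewrite -lee_fin -Xp. Qed.

Lemma has_pmf_neq0 X p : has_pmf X p -> exists k, p k != 0.
Proof.
move=> Xp; apply: contrapT => /forallNP p0.
have := has_pmf_series Xp; rewrite eseries0.
  by move=> /eqP; rewrite eq_sym onee_eq0.
by move=> k _ _; have /negP/negPn/eqP -> := p0 k.
Qed.

Lemma has_pmf_unique X Y p A : has_pmf X p -> has_pmf Y p ->
  P (X @^-1` A) = P (Y @^-1` A).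
Proof.
move=> Xp Yp; rewrite !RV_nat_series.
by apply: eq_eseriesr => k _; rewrite Xp Yp.
Qed.

Definition tail X (n : nat) : R := fine (P (X @^-1` [set k | (n <= k)%N])).

Lemma tail_ge0 X n : 0 <= tail X n.
Proof. exact: fine_ge0. Qed.

Lemma tailS X p n : has_pmf X p -> tail X n = p n + tail X n.+1.
Proof.
move=> Xp; apply: EFin_inj; rewrite EFinD !fineK ?fin_num_measure//;
  try exact: measurable_RV_nat.
rewrite -Xp -measureU; first last.
- by rewrite -subset0 => t [/= -> /=]; rewrite ltnn.
- exact: measurable_RV_nat.
- exact: measurable_RV_nat.
congr (P _); apply/seteqP; split => t /=.
  by rewrite leq_eqVlt => /orP[/eqP ->|?]; [left|right].
by case=> [->//|/ltnW].
Qed.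

Lemma tail_cvg0 X : tail X n @[n --> \oo] --> (0 : R).
Proof.
have H : (P (X @^-1` [set k | (n <= k)%N])) @[n --> \oo] --> (0%:E : \bar R).
  have B0 : \bigcap_n (X @^-1` [set k | (n <= k)%N]) = set0.
    by rewrite -subset0 => t /(_ (X t).+1 I) /=; rewrite ltnn.
  rewrite -[0%:E](measure0 P) -B0; apply: nonincreasing_cvg_mu => //.
  - by rewrite ltey_eq fin_num_measure//; exact: measurable_RV_nat.
  - by move=> n; exact: measurable_RV_nat.
  - by rewrite B0.
  - by move=> m n mn; apply/subsetPset => t /=; exact: leq_trans.
exact: (fine_cvg H).
Qed.

(** The bound on [p] telescopes over finite stretches. In the limit the far tail vanishes, and the
    remaining value of [f] may be dropped because it is nonnegative. *)
Lemma tail_le X p (f : nat -> R) n : has_pmf X p -> (forall k, 0 <= f k) ->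
  (forall k, (n <= k)%N -> p k <= f k - f k.+1) -> tail X n <= f n.
Proof.
move=> Xp f0 pf.
have step j : tail X n - tail X (j + n) <= f n - f (j + n)%N.
  elim: j => [|j IH]; first by rewrite add0n !subrr.
  have := pf (j + n)%N (leq_addl _ _); have := tailS (j + n) Xp.
  rewrite addSn; lra.
have cv : (tail X n - tail X (j + n)) @[j --> \oo] --> tail X n - 0.
  by apply: cvgB; [exact: cvg_cst|rewrite cvg_shiftn; exact: tail_cvg0].
rewrite -[leLHS]subr0 -(cvg_lim _ cv)//; apply: limr_le.
  by apply/cvg_ex; eexists; exact: cv.
by apply: nearW => j; have := step j; have := f0 (j + n)%N; lra.
Qed.

(** The roles are exchanged with respect to [tail_le]: here the far tail is dropped by its sign, and
    it is [g] that has to become small. *)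
Lemma tail_ge X p (g : nat -> R) n : has_pmf X p ->
  (forall e, 0 < e -> exists j, g (j + n)%N <= e) ->
  (forall k, (n <= k)%N -> g k - g k.+1 <= p k) -> g n <= tail X n.
Proof.
move=> Xp g0 pg; apply/ler_addgt0Pr => e /g0[j gj].
have : g n - g (j + n)%N <= tail X n - tail X (j + n).
  elim: j {gj} => [|j IH]; first by rewrite add0n !subrr.
  have := pg (j + n)%N (leq_addl _ _); have := tailS (j + n) Xp.
  rewrite addSn; lra.
have := tail_ge0 X (j + n); lra.
Qed.

End nat_random_variable.

(** * Comparing the bias with a single grandchild count *)

Section friendship_bias.
Context d (T : measurableType d) (R : realType) (P : probability T R).
Variables (p : nat -> R) (N : seq nat -> {RV P >-> nat}).

Lemma measurable_friendship_bias (x : R) :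
  measurable [set t | x <= friendship_bias N t].
Proof.
(* Freezing the degree at [n] turns the random summation range into a fixed one; the event is a
   countable union over [n]. *)
pose bias n t : R :=
  (\sum_(1 <= j < n.+1) (N [:: j] t + 1)%N%:R) / n%:R - n%:R.
have -> : [set t | x <= friendship_bias N t] =
    \bigcup_n (N [::] @^-1` [set n] `&` (setT `&` [set t | x <= bias n t])).
  apply/seteqP; split=> [t xt|t [n _ [/= <- [_ //]]]].
  by exists (N [::] t).
apply: bigcup_measurable => n _; apply: measurableI.
  exact: measurable_RV_nat.
apply: measurable_fun_le => //.
apply: measurable_funD; last exact: measurable_cst.
apply: measurable_funM; last exact: measurable_cst.
apply: measurable_sum => j.
exact: (@measurableT_comp _ _ _ _ _ _ (fun k : nat => (k + 1)%:R : R)).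
Qed.

Hypothesis N_bp : unimodular_bp p N.

Lemma probability_root_child (j : nat) (A B : set nat) :
  P (N [::] @^-1` A `&` N [:: j] @^-1` B) =
  (P (N [::] @^-1` A) * P (N [:: j] @^-1` B))%E.
Proof.
pose C (v : seq nat) := if v is [::] then A else B.
have := ubp_indep N_bp (s := [:: [::]; [:: j]]) (A := C) erefl (fun _ _ => I).
rewrite big_cons big_seq1 /= => <-; congr (P _); apply/seteqP; split.
  by move=> t [tA tB] v /=; rewrite !inE => /orP[] /eqP ->.
by move=> t tAB; split; [apply: (tAB [::])|apply: (tAB [:: j])];
  rewrite /= !inE eqxx ?orbT.
Qed.

(** If all counts were below [x], each summand, count plus 1, would be below [x + n.+1], because the
    root degree [n.+1] is at least 1; averaging and subtracting that degree would leave a bias below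
    [x]. *)
Lemma friendship_bias_child (t : T) (n : nat) (x : R) :
  N [::] t = n.+1 -> x <= friendship_bias N t ->
  exists2 j, (j < n.+1)%N & x <= (N [:: j.+1] t)%:R.
Proof.
move=> tn; apply: contraPP => /forall2NP lt_x; apply/negP; rewrite -ltNge.
rewrite /friendship_bias /root_children tn.
have n0 : 0 < n.+1%:R :> R by rewrite ltr0n.
rewrite ltrBlDr ltr_pdivrMr// big_add1 /= big_mkord.
have -> : (x + n.+1%:R) * n.+1%:R = \sum_(j < n.+1) (x + n.+1%:R).
  by rewrite sumr_const card_ord mulr_natr.
apply: ltr_sum => //.
  by apply/hasP; exists ord0; rewrite // mem_index_enum.
move=> j _; have [/(_ (ltn_ord j))//|/negP] := lt_x (j : nat).
rewrite -ltNge => ltx; rewrite /grandchildren natrD ltr_leD// ler_nat//.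
Qed.

Let m : R := fine ('E_P[fun t => (N [::] t)%:R]).
Let Q (x : R) := P [set t | x <= (grandchildren N 1 t)%:R].

Lemma grandchildren_tail (j : nat) (x : R) :
  P (N [:: j] @^-1` [set k | x <= k%:R]) = Q x.
Proof.
by apply: (has_pmf_unique (p := size_biased p m));
  apply: (ubp_offspring N_bp).
Qed.

Lemma friendship_bias_ge (x : R) :
  ((p 1)%:E * Q x <= P [set t | (x <= friendship_bias N t)%R])%E.
Proof.
rewrite -(ubp_root N_bp) -(grandchildren_tail 1) -probability_root_child.
apply: le_measure; rewrite ?inE; first 1 last.
- exact: measurable_friendship_bias.
(* For a single child, the summand 1 cancels against the root degree 1. *)
- move=> t [/= t1 xt]; rewrite /friendship_bias /root_children t1.
  by rewrite big_nat1 divr1 natrD addrK.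
- by apply: measurableI; exact: measurable_RV_nat.
Qed.

Lemma friendship_bias_le (x : R) : m != 0 -> 0 < x ->
  (P [set t | (x <= friendship_bias N t)%R] <= m%:E * Q x)%E.
Proof.
move=> m0 x0.
have sb1 : (\sum_(0 <= k <oo) (size_biased p m k)%:E = 1)%E.
  exact: (has_pmf_series (ubp_offspring N_bp (v := [:: 1%N]) isT)).
have sb0 k : 0 <= size_biased p m k.
  exact: (has_pmf_ge0 _ (ubp_offspring N_bp (v := [:: 1%N]) isT)).
have p0 k : 0 <= p k by exact: (has_pmf_ge0 _ (ubp_root N_bp)).
have Qfin : Q x \is a fin_num.
  rewrite -(grandchildren_tail 1) fin_num_measure//.
  exact: measurable_RV_nat.
pose F n := N [::] @^-1` [set n.+1] `&` [set t | x <= friendship_bias N t].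
have mF n : measurable (F n).
  apply: measurableI; first exact: measurable_RV_nat.
  exact: measurable_friendship_bias.
apply: (@le_trans _ _ (\sum_(0 <= n <oo) P (F n))%E).
  apply: measure_sigma_subadditive => //.
    exact: measurable_friendship_bias.
  (* The events [F n] omit a childless root: division by 0 gives 0, so its bias is 0, which is below
     [x]. *)
  move=> t /= xt; case E: (N [::] t) => [|n]; last by exists n.
  move: xt; rewrite /friendship_bias /root_children E invr0 mulr0 subr0; lra.
apply: (@le_trans _ _
    (\sum_(0 <= n <oo) ((n.+1%:R * p n.+1)%:E * Q x))%E); last first.
  (* The factor [m] comes from the total mass 1 of the size-biased law, so the expectation behind
     [m] is never evaluated. *)
  rewrite (eq_eseriesr (g := fun n =>
    ((m * fine (Q x))%:E * (size_biased p m n)%:E)%E)).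
    rewrite nneseriesZl ?sb1 ?mule1 ?EFinM ?(fineK Qfin) // => k _.
    by rewrite lee_fin.
  move=> n _; rewrite -(fineK Qfin) -!EFinM; congr EFin.
  by rewrite /size_biased; field.
apply: lee_nneseries => // n _.
pose G n j :=
  N [::] @^-1` [set n.+1] `&` N [:: j.+1] @^-1` [set k | x <= k%:R].
(* By independence and the common law of the counts, the [n.+1] terms of the union bound are
   equal. *)
have -> : ((n.+1%:R * p n.+1)%:E * Q x = \sum_(j < n.+1) P (G n j))%E.
  under eq_bigr do
    rewrite probability_root_child grandchildren_tail (ubp_root N_bp).
  rewrite -(fineK Qfin) -!EFinM sumEFin sumr_const card_ord.
  by rewrite mulr_natl mulrnAl.
apply: (content_subadditive P (F := G n)) => //.
  by move=> k _; apply: measurableI; exact: measurable_RV_nat.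
move=> t [/= tn /(friendship_bias_child tn)[j jn xj]].
by rewrite -bigcup_mkord; exists j.
Qed.

End friendship_bias.

(** * Power-law tails for the zeta distribution *)

Section zeta_law.
Context d (T : measurableType d) (R : realType) (P : probability T R).
Variables (tau : R) (N : seq nat -> {RV P >-> nat}).
Hypothesis tau_gt2 : 2 < tau.
Hypothesis N_bp : unimodular_bp (zeta_pmf tau) N.

Let m : R := fine ('E_P[fun t => (N [::] t)%:R]).
Let a := tau - 2.
Let child_pmf : has_pmf (N [:: 1%N]) (size_biased (zeta_pmf tau) m).
Proof. exact: (ubp_offspring N_bp). Qed.

(* Since [x / 0 = 0], a probability mass function divided by [zeta tau] or [m]
   would vanish identically if that constant were [0]; no convergence of the
   defining series is needed. *)
Lemma zeta_gt0 : 0 < zeta tau.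
Proof.
rewrite -invr_gt0 lt0r; apply/andP; split.
  have [[|k] /= ] := has_pmf_neq0 (ubp_root N_bp); first by rewrite eqxx.
  by apply: contra => /eqP ->; rewrite mulr0.
by have := has_pmf_ge0 1 (ubp_root N_bp); rewrite /= powR1 mul1r.
Qed.

Lemma mean_gt0 : 0 < m.
Proof.
rewrite -invr_gt0 lt0r; apply/andP; split.
  have [k] := has_pmf_neq0 child_pmf.
  by apply: contra => /eqP h; rewrite /size_biased h mulr0.
have := has_pmf_ge0 0 child_pmf; rewrite /size_biased /= powR1 !mul1r.
by rewrite pmulr_rge0// invr_gt0 zeta_gt0.
Qed.

Let c := (zeta tau * m)^-1.
Let c_gt0 : 0 < c. Proof. by rewrite invr_gt0 mulr_gt0 ?zeta_gt0 ?mean_gt0. Qed.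
Let a_gt0 : 0 < a. Proof. by rewrite subr_gt0. Qed.
Let ca_ge0 : 0 <= c / a. Proof. by rewrite divr_ge0 ?ltW. Qed.

Lemma size_biased_zeta k :
  size_biased (zeta_pmf tau) m k = c * k.+1%:R `^ (- (a + 1)).
Proof.
have k0 : (0 : R) < k.+1%:R by rewrite ltr0n.
have -> : - (a + 1) = 1 + - tau by rewrite /a; ring.
rewrite powRD ?(gt_eqF k0) ?implybT// powRr1 ?ltW//.
rewrite /size_biased /= /c; field.
by rewrite !gt_eqF ?zeta_gt0 ?mean_gt0.
Qed.

(** The mass at [k] is [c] times the power at the right end of the interval from [k] to [k.+1],
    where [powRN_sub_ge] applies. The case [n = 0] must be excluded: 0 to the power [- a] is 0 by
    convention, whereas the tail is 1. *)
Lemma child_tail_le n : (0 < n)%N ->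
  tail (N [:: 1%N]) n <= c / a * n%:R `^ (- a).
Proof.
move=> n0; apply: (tail_le (f := fun n => c / a * n%:R `^ (- a)) child_pmf).
  by move=> k; rewrite mulr_ge0 ?powR_ge0.
move=> k nk; rewrite size_biased_zeta.
have k0 : (0 : R) < k%:R by rewrite ltr0n (leq_trans n0).
have kk : (k%:R : R) <= k.+1%:R by rewrite ler_nat.
have := powRN_sub_ge a_gt0 k0 kk.
have -> : k.+1%:R - k%:R = 1 :> R by rewrite -natr1; ring.
rewrite mulr1 => h.
by rewrite -[leRHS]mulrBr -[leRHS]mulrA ler_pM2l// ler_pdivlMl.
Qed.

(** The mass at [k] now sits at the left end of the interval from [k.+1] to [k.+2], whence the shift
    by one in the bound. *)
Lemma child_tail_ge n : c / a * n.+1%:R `^ (- a) <= tail (N [:: 1%N]) n.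
Proof.
apply: (tail_ge (g := fun n => c / a * n.+1%:R `^ (- a)) child_pmf).
  move=> e e0; have [|K HK] := @powRN_eventually_le _ a a_gt0 (e / (c / a)).
    by rewrite !divr_gt0.
  exists K; rewrite -ler_pdivlMl ?divr_gt0// mulrC; apply: HK.
  by rewrite -addnS leq_addr.
move=> k nk; rewrite size_biased_zeta.
have k0 : (0 : R) < k.+1%:R by rewrite ltr0n.
have kk : (k.+1%:R : R) <= k.+2%:R by rewrite ler_nat.
have := powRN_sub_le a_gt0 k0 kk.
have -> : k.+2%:R - k.+1%:R = 1 :> R by rewrite -[k.+2%:R]natr1; ring.
rewrite mulr1 => h.
by rewrite -[leLHS]mulrBr -[leLHS]mulrA ler_pM2l// ler_pdivrMl.
Qed.

Let Q (x : R) : R := fine (P [set t | x <= (grandchildren N 1 t)%:R]).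

(** An integer is at least [x] exactly when it is at least the ceiling of [x], a natural number here
    since [x] is nonnegative. *)
Let QE (x : R) : 0 <= x ->
  exists2 n : nat, x <= n%:R < x + 1 & Q x = tail (N [:: 1%N]) n.
Proof.
move=> x0; have cx0 : 0 <= Num.ceil x by rewrite ceil_ge0; lra.
exists `|Num.ceil x|%N.
  rewrite natr_absz ger0_norm//; have := ceil_itv x; rewrite intrB; lra.
rewrite /Q /tail; congr (fine (P _)); apply/seteqP; split=> t /=;
  by rewrite -lez_nat gez0_abs// ceil_le_int.
Qed.

Lemma grandchildren_ge (x : R) :
  2 <= x -> c / a * 2 `^ (- a) <= Q x / x `^ (- a).
Proof.
move=> x2; have x0 : 0 < x by lra.
rewrite ler_pdivlMr ?powR_gt0// -[leLHS]mulrA -powRM//; last lra.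
have [|n /andP[_ nx] ->] := QE (x := x); first lra.
apply: le_trans (child_tail_ge n).
(* From [n < x + 1] and [2 <= x] follows [n + 1 < x + 2 <= 2 * x]; this fixes both the threshold 2
   and the factor 2 in the constant. *)
rewrite ler_wpM2l ?ca_ge0//; apply: ge_powRN => //.
by rewrite -natr1; lra.
Qed.

Lemma grandchildren_le (x : R) : 2 <= x -> Q x / x `^ (- a) <= c / a.
Proof.
move=> x2; have x0 : 0 < x by lra.
rewrite ler_pdivrMr ?powR_gt0//.
have [|n /andP[nx _] ->] := QE (x := x); first lra.
have n0 : (0 : R) < n%:R by lra.
apply: le_trans (child_tail_le _) _; first by rewrite -(ltr0n R).
by rewrite ler_wpM2l ?ca_ge0//; apply: ge_powRN.
Qed.

Lemma friendship_bias_ratio (x : R) : 2 <= x ->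
  (zeta tau)^-1 <= fine (P [set t | x <= friendship_bias N t]) / Q x <= m.
Proof.
move=> x2; have x0 : 0 < x by lra.
have Q0 : 0 < Q x.
  have := grandchildren_ge x2; rewrite ler_pdivlMr ?powR_gt0//.
  apply: lt_le_trans.
  by rewrite mulr_gt0 ?powR_gt0// mulr_gt0 ?powR_gt0// divr_gt0.
have Qfin : P [set t | x <= (grandchildren N 1 t)%:R] \is a fin_num.
  apply: fin_num_measure.
  exact: (measurable_RV_nat (N [:: 1%N]) [set k | x <= k%:R]).
have Bfin : P [set t | x <= friendship_bias N t] \is a fin_num.
  by apply: fin_num_measure; exact: measurable_friendship_bias.
rewrite ler_pdivlMr// ler_pdivrMr// -!lee_fin !EFinM (fineK Qfin) (fineK Bfin).
apply/andP; split.
  (* The mass at 1 is the inverse of [zeta tau], as 1 to any power is 1. *)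
  by have := friendship_bias_ge N_bp x; rewrite /= powR1 mul1r.
by apply: (friendship_bias_le N_bp) => //; rewrite gt_eqF ?mean_gt0.
Qed.

End zeta_law.

Theorem theorem4p9 (d : measure_display) (T : measurableType d)
    (R : realType) (P : probability T R) (tau : R)
    (N : seq nat -> {RV P >-> nat}) :
  2 < tau ->
  unimodular_bp (zeta_pmf tau) N ->
  asymp (fun x => fine (P [set t | x <= friendship_bias N t]))
        (fun x => fine (P [set t | x <= (grandchildren N 1 t)%:R])) /\
  asymp (fun x => fine (P [set t | x <= friendship_bias N t]))
        (fun x => x `^ (- (tau - 2))).
Proof.
move=> tau2 N_bp; have z0 := zeta_gt0 N_bp; have m0 := mean_gt0 N_bp.
set m := fine _ in m0; set a := tau - 2.
have a0 : 0 < a by rewrite subr_gt0.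
split.
  apply: (@asymp_of_bounds _ _ _ 2 (zeta tau)^-1 m); first by rewrite invr_gt0.
  exact: friendship_bias_ratio.
(* The constant shared by the two bounds on the grandchild tail; the bounds for the bias are
   products of these with the bounds on the ratio of the two tails. *)
pose c := (zeta tau * m)^-1 / a.
have c0 : 0 < c by rewrite divr_gt0 ?invr_gt0 ?mulr_gt0.
apply: (@asymp_of_bounds _ _ _ 2 ((zeta tau)^-1 * (c * 2 `^ (- a))) (m * c)).
  by rewrite mulr_gt0 ?invr_gt0// mulr_gt0 ?powR_gt0.
move=> x x2.
have /andP[b1 b2] := friendship_bias_ratio tau2 N_bp x2.
have q1 := grandchildren_ge tau2 N_bp x2.
have q2 := grandchildren_le tau2 N_bp x2.
move: b1 b2 q1 q2; set b := fine _; set q := fine (P _).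
rewrite -/m -/a -/c => b1 b2 q1 q2.
(* If [q] were 0, the quotient [b / q] would be 0 by convention, against its positive lower bound
   [b1]. *)
have q0 : q != 0.
  by apply: contraTneq b1 => ->; rewrite invr0 mulr0 -ltNge invr_gt0.
have -> : b / x `^ (- a) = (b / q) * (q / x `^ (- a)).
  by rewrite mulrA divfK.
apply/andP; split; apply: ler_pM => //.
- by rewrite invr_ge0 ltW.
- by rewrite mulr_ge0 ?powR_ge0 ?ltW.
- by rewrite (le_trans _ b1)// invr_ge0 ltW.
- by rewrite (le_trans _ q1)// mulr_ge0 ?powR_ge0 ?ltW.
Qed.
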